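(* Let $(H,r)\colon\mathcal{B}\to\mathcal{A}$ be a degree-preserving functor in $G\text{-}\mathbf{GrCat}$ (i.e. between small $G$-graded categories). Then the following are equivalent: (1) $(H,r)$ is an equivalence in the $2$-category $G\text{-}\mathbf{GrCat}$. (2) $H\colon\mathcal{B}\to\mathcal{A}$ is an equivalence of categories with a quasi-inverse $I\colon\mathcal{A}\to\mathcal{B}$ as a left adjoint, both of whose counit $\varepsilon\colon IH\Rightarrow\mathrm{id}_{\mathcal{B}}$ and unit $\eta\colon\mathrm{id}_{\mathcal{A}}\Rightarrow HI$ are homogeneous natural isomorphisms. (3) $H$ is fully faithful and homogeneously dense. In (2), $I$ is made into a quasi-inverse $(I,s)$ of $(H,r)$ in $G\text{-}\mathbf{GrCat}$ with $\varepsilon$ the counit and $\eta$ the unit in a unique way; the degree adjuster $s$ is given by $$s=(s_x)_{x\in\mathcal{A}_0}\quad\text{with}\quad s_x:=(\deg\eta_x)^{-1}\,r_{Ix}^{-1}\in G\ \text{ for all }x\in\mathcal{A}_0.$$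
   Context: Throughout, $G$ is a group, $\Bbbk$ is a commutative ring, and all categories and functors are $\Bbbk$-linear. $\mathcal{B}_0$ is the class of objects of $\mathcal{B}$. A $G$-graded category is a $\Bbbk$-category $\mathcal{B}$ with decompositions $\mathcal{B}(x,y)=\bigoplus_{a\in G}\mathcal{B}^a(x,y)$ of $\Bbbk$-modules such that $\mathcal{B}^b(y,z)\cdot\mathcal{B}^a(x,y)\subseteq\mathcal{B}^{ba}(x,z)$. A morphism $f$ is homogeneous if $f\in\mathcal{B}^a(x,y)$ for some $a\in G$, and then $\deg f:=a$. A degree-preserving functor $\mathcal{B}\to\mathcal{A}$ is a pair $(H,r)$ of a $\Bbbk$-functor $H$ and a map $r\colon\mathcal{B}_0\to G$ (the degree adjuster) with $H(\mathcal{B}^a(x,y))\subseteq\mathcal{A}^{r_y^{-1}ar_x}(Hx,Hy)$ for all $x,y\in\mathcal{B}_0$, $a\in G$. A morphism $(H,r)\to(I,s)$ of degree-preserving functors $\mathcal{B}\to\mathcal{A}$ is a natural transformation $\theta\colon H\Rightarrow I$ with $\theta x\in\mathcal{A}^{s_x^{-1}r_x}(Hx,Ix)$ for all $x$. The composite is $(H',r')(H,r)=(H'H,(r_xr'_{Hx})_x)$. The 2-category $G\text{-}\mathbf{GrCat}$ has small $G$-graded categories as objects, degree-preserving functors as 1-morphisms, and these morphisms as 2-morphisms, with identity 1-morphisms $(\mathrm{id},1)$ and the usual compositions of natural transformations. A natural transformation $\epsilon\colon E\Rightarrow F$ between functors into a $G$-graded category is homogeneous if every component $\epsilon_x$ is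 homogeneous. A subclass $\mathcal{S}$ of $\mathcal{B}_0$ is homogeneously dense in a $G$-graded category $\mathcal{B}$ if for each $x\in\mathcal{B}_0$ there exist $x'\in\mathcal{S}$ and a homogeneous isomorphism $x\to x'$. A functor $F\colon\mathcal{X}\to\mathcal{B}$ is homogeneously dense if $F(\mathcal{X}_0)$ is homogeneously dense in $\mathcal{B}$.
   Formalization: Where η_x = 0 (x a zero object) deg η_x is undetermined and s_x is not unique; the formal statement asserts the formula for s_x with some admissible degree of η_x, and uniqueness of s_x only at those x with η_x ≠ 0. *)

(* Defs.v *)
From HB Require Import structures.
From mathcomp Require Import all_boot all_algebra.

Set Implicit Arguments.
Unset Strict Implicit.
Unset Printing Implicit Defensive.

Import GRing.Theory.
Local Open Scope ring_scope.


Record kCat (k : comPzRingType) := KCat {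
  ob : Type;
  hom : ob -> ob -> lmodType k;
  idm : forall x, hom x x;
  comp : forall x y z, hom y z -> hom x y -> hom x z;
  comp_linearl : forall x y z (f : hom x y), linear (fun g : hom y z => comp g f);
  comp_linearr : forall x y z (g : hom y z), linear (fun f : hom x y => comp g f);
  comp1m : forall x y (f : hom x y), comp (idm y) f = f;
  compm1 : forall x y (f : hom x y), comp f (idm x) = f;
  compA : forall x y z w (h : hom z w) (g : hom y z) (f : hom x y),
    comp h (comp g f) = comp (comp h g) f
}.

Arguments hom {k} C x y : rename.
Arguments idm {k C} x : rename.
Arguments comp {k C x y z} g f : rename.

Declare Scope cat_scope.
Delimit Scope cat_scope with cat.
Local Open Scope cat_scope.
Notation "g ∘ f" := (comp g f) (at level 40, left associativity) : cat_scope.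

Section Functors.
Variable k : comPzRingType.
Implicit Types C D E : kCat k.

Definition is_iso C (x y : ob C) (f : hom C x y) : Prop :=
  exists g : hom C y x, g ∘ f = idm x /\ f ∘ g = idm y.

Record kFunctor C D := KFunctor {
  fob :> ob C -> ob D;
  fmap : forall x y, {linear hom C x y -> hom D (fob x) (fob y)};
  fmap_id : forall x, fmap x x (idm x) = idm (fob x);
  fmap_comp : forall x y z (g : hom C y z) (f : hom C x y),
    fmap x z (g ∘ f) = fmap y z g ∘ fmap x y f
}.

Definition kid C : kFunctor C C :=
  @KFunctor C C id (fun x y => idfun) (fun=> erefl) (fun _ _ _ _ _ => erefl).

Section Comp.
Variables (C D E : kCat k) (F' : kFunctor D E) (F : kFunctor C D).

Let cmap x y : {linear hom C x y -> hom E (F' (F x)) (F' (F y))} :=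
  fmap F' (F x) (F y) \o fmap F x y.

Fact kcomp_id x : cmap x x (idm x) = idm (F' (F x)).
Proof. by rewrite /cmap /= !fmap_id. Qed.

Fact kcomp_comp x y z (g : hom C y z) (f : hom C x y) :
  cmap x z (g ∘ f) = cmap y z g ∘ cmap x y f.
Proof. by rewrite /cmap /= !fmap_comp. Qed.

Definition kcomp : kFunctor C E :=
  @KFunctor C E (fun x => F' (F x)) cmap kcomp_id kcomp_comp.
End Comp.

Record natTrans C D (F F' : kFunctor C D) := NatTrans {
  ntc :> forall x, hom D (F x) (F' x);
  ntc_nat : forall x y (f : hom C x y),
    fmap F' x y f ∘ ntc x = ntc y ∘ fmap F x y f
}.

Definition natIso C D (F F' : kFunctor C D) (t : natTrans F F') : Prop :=
  forall x, is_iso (t x).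

Definition fully_faithful C D (F : kFunctor C D) : Prop :=
  forall x y, injective (fmap F x y) /\
    (forall g : hom D (F x) (F y), exists f : hom C x y, fmap F x y f = g).

(* [L] is left adjoint to [R] with unit [eta] and counit [eps]: the two
   triangle identities. *)
Definition is_adjunction C D (L : kFunctor D C) (R : kFunctor C D)
    (eta : natTrans (kid D) (kcomp R L)) (eps : natTrans (kcomp L R) (kid C)) :
    Prop :=
  (forall x : ob D, eps (L x) ∘ fmap L x (R (L x)) (eta x) = idm (L x)) /\
  (forall y : ob C, fmap R (L (R y)) y (eps y) ∘ eta (R y) = idm (R y)).

End Functors.


Section Graded.
Variables (G : groupType) (k : comPzRingType).

(* [V] is the internal direct sum of the submodules [W a], [a : G].  Families
   are given as total functions, of which only the values on a finite
   duplicate-free support are used. *)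
Record direct_sum (V : lmodType k) (W : G -> V -> Prop) : Prop := DirectSum {
  ds_zero : forall a, W a 0;
  ds_linear : forall a (c : k) u v, W a u -> W a v -> W a (c *: u + v);
  ds_span : forall v, exists (s : seq G) (w : G -> V),
    [/\ uniq s, forall a, W a (w a) & v = \sum_(a <- s) w a];
  ds_indep : forall (s : seq G) (w : G -> V),
    uniq s -> (forall a, W a (w a)) -> \sum_(a <- s) w a = 0 ->
    forall a, a \in s -> w a = 0
}.

Record grCat := GrCat {
  gcat :> kCat k;
  in_deg : forall x y, G -> hom gcat x y -> Prop;
  in_deg_direct : forall x y, direct_sum (@in_deg x y);
  in_deg_comp : forall x y z (a b : G) (g : hom gcat y z) (f : hom gcat x y),
    in_deg b g -> in_deg a f -> in_deg (b * a)%g (g ∘ f)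
}.

(* [in_deg a f] says that [f] lies in the component of degree [a].  It is a
   relation because the zero morphism lies in every component. *)
Arguments in_deg {B x y} a f : rename.

Implicit Types B A : grCat.

Definition homogeneous B (x y : ob B) (f : hom B x y) : Prop :=
  exists a : G, in_deg a f.

Definition homogeneousT (C : kCat k) B (E F : kFunctor C B)
    (t : natTrans E F) : Prop :=
  forall x, homogeneous (t x).

Definition homog_dense_class B (S : ob B -> Prop) : Prop :=
  forall x : ob B, exists x' : ob B, S x' /\
    exists f : hom B x x', homogeneous f /\ is_iso f.

Definition homog_dense (C : kCat k) B (F : kFunctor C B) : Prop :=
  homog_dense_class (fun y => exists x : ob C, y = F x).

(* Not an axiom of [grCat]: it follows from the direct sum decompositions. *)
Lemma in_deg_id B (x : ob B) : in_deg 1%g (idm x).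
Proof.
have [s [w [us Ww e1]]] := ds_span (@in_deg_direct B x x) (idm x).
pose w1 : hom B x x := if 1%g \in s then w 1%g else 0.
have W1 : in_deg 1%g w1.
  by rewrite /w1; case: ifP => _ //; apply: ds_zero; apply: in_deg_direct.
have degB (y z : ob B) a (u v : hom B y z) : in_deg a u -> in_deg a v -> in_deg a (u - v).
  move=> hu hv; rewrite addrC -scaleN1r.
  exact: (ds_linear (@in_deg_direct B y z)).
have key b (f : hom B x x) : in_deg b f -> f ∘ w1 = f.
  move=> hf; have D := @in_deg_direct B x x.
  pose t := (1%g : G) :: rem 1%g s.
  pose v a := if a \in s then w a else 0.
  have Wv a : in_deg a (v a).
    by rewrite /v; case: ifP => _ //; apply: ds_zero.
  have ut : uniq t by rewrite /= rem_uniq // mem_rem_uniqF.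
  have et : idm x = \sum_(a <- t) v a.
    rewrite big_cons {1}/v e1; case: ifP => h1.
      rewrite (big_rem (1 : G)%g) //=; congr (_ + _).
      rewrite !big_seq; apply: eq_bigr => a; rewrite mem_rem_uniq // inE.
      by case/andP=> _ ha; rewrite /v ha.
    rewrite add0r rem_id ?h1 // !big_seq; apply: eq_bigr => a ha.
    by rewrite /v ha.
  pose fm := HB.pack_for {linear hom B x x -> hom B x x} (fun g : hom B x x => f ∘ g)
    (GRing.isLinear.Build _ _ _ _ _ (@comp_linearr _ B x x x f)).
  have ef : f = \sum_(a <- t) (f ∘ v a).
    rewrite -[LHS](@compm1 _ B) et; exact: (linear_sum fm).
  pose u c : hom B x x :=
    f ∘ v (b^-1 * c)%g - (if c == b then f else 0).
  have hb : b \in map (fun a => b * a)%g t.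
    by rewrite /= inE mulg1 eqxx.
  have := @ds_indep _ _ D (map (fun a => b * a)%g t) u _ _ _ b hb.
  rewrite /u eqxx mulVg /v -/w1 => H; apply/eqP; rewrite -subr_eq0; apply/eqP.
  apply: H.
  - by rewrite map_inj_uniq //; apply: mulgI.
  - move=> c; apply: degB.
      by rewrite -{1}(mulVKg b c); apply: in_deg_comp => //; apply: Wv.
    by case: eqP => [->|_] //; apply: ds_zero.
  - rewrite big_map big_split /= sumrN.
    under eq_bigr do rewrite mulKg.
    rewrite -/v -ef big_cons mulg1 eqxx big_seq big1 ?addr0 ?subrr // => a ha.
    case: eqP => // /(canRL (mulKg b)); rewrite mulVg => ea.
    by move: ut; rewrite /= -{1}ea ha.
rewrite [X in in_deg _ X](_ : _ = w1) //.
pose mw := HB.pack_for {linear hom B x x -> hom B x x} (fun g : hom B x x => g ∘ w1)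
  (GRing.isLinear.Build _ _ _ _ _ (@comp_linearl _ B x x x w1)).
rewrite -[RHS](@comp1m _ B) {2}e1 [RHS](linear_sum mw) e1.
by apply: eq_bigr => a _; rewrite /= (key a).
Qed.


Definition degree_preserving B A (H : kFunctor B A) (r : ob B -> G) : Prop :=
  forall (x y : ob B) (a : G) (f : hom B x y),
    in_deg a f -> in_deg ((r y)^-1 * a * r x)%g (fmap H x y f).

Record grFunctor B A := GrFunctor {
  gfun :> kFunctor B A;
  adjuster : ob B -> G;
  gfun_deg : degree_preserving gfun adjuster
}.

Arguments adjuster {B A} H x : rename.

Fact grid_deg B : degree_preserving (kid B) (fun=> 1%g).
Proof. by move=> x y a f; rewrite invg1 mul1g mulg1. Qed.

Definition grid B : grFunctor B B := GrFunctor (@grid_deg B).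

Section GrComp.
Variables (C B A : grCat) (H' : grFunctor B A) (H : grFunctor C B).

Fact grcomp_deg :
  degree_preserving (kcomp H' H) (fun x => adjuster H x * adjuster H' (H x))%g.
Proof.
move=> x y a f /(gfun_deg H) /(gfun_deg H').
by rewrite invgM !mulgA.
Qed.

Definition grcomp : grFunctor C A := GrFunctor grcomp_deg.
End GrComp.

Definition degreeT B A (H I : grFunctor B A) (t : natTrans H I) : Prop :=
  forall x, in_deg ((adjuster I x)^-1 * adjuster H x)%g (t x).

Record grTrans B A (H I : grFunctor B A) := GrTrans {
  gtrans :> natTrans H I;
  gtrans_deg : degreeT gtrans
}.

Section TwoCells.
Variables B A : grCat.

Section Id.
Variable H : grFunctor B A.

Fact idt_nat x y (f : hom B x y) :
  fmap H x y f ∘ idm (H x) = idm (H y) ∘ fmap H x y f.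
Proof. by rewrite compm1 comp1m. Qed.

Fact idt_deg : degreeT (NatTrans idt_nat).
Proof. by move=> x; rewrite mulVg; apply: in_deg_id. Qed.

Definition gridt : grTrans H H := GrTrans idt_deg.
End Id.

Section Vert.
Variables (H I J : grFunctor B A) (u : grTrans I J) (t : grTrans H I).

Fact vcomp_nat x y (f : hom B x y) :
  fmap J x y f ∘ (u x ∘ t x) = (u y ∘ t y) ∘ fmap H x y f.
Proof. by rewrite compA ntc_nat -!compA ntc_nat. Qed.

Fact vcomp_deg : degreeT (NatTrans vcomp_nat).
Proof.
move=> x; have := in_deg_comp (gtrans_deg u x) (gtrans_deg t x).
by rewrite -mulgA mulVKg.
Qed.

Definition grvcomp : grTrans H J := GrTrans vcomp_deg.
End Vert.

(* Stands for equality of 2-morphisms, so that the proof components of [natTrans]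
   and [grTrans] play no role. *)
Definition grteq (H I : grFunctor B A) (t u : grTrans H I) : Prop :=
  forall x, t x = u x.

Definition invertible2 (H I : grFunctor B A) (t : grTrans H I) : Prop :=
  exists u : grTrans I H,
    grteq (grvcomp u t) (gridt H) /\ grteq (grvcomp t u) (gridt I).

End TwoCells.

Definition quasi_inverse B A (H : grFunctor B A) (I : grFunctor A B)
    (eps : grTrans (grcomp I H) (grid B))
    (eta : grTrans (grid A) (grcomp H I)) : Prop :=
  invertible2 eps /\ invertible2 eta.

Definition gr_equivalence B A (H : grFunctor B A) : Prop :=
  exists (I : grFunctor A B) (eps : grTrans (grcomp I H) (grid B))
    (eta : grTrans (grid A) (grcomp H I)), quasi_inverse eps eta.


(* [I] is a quasi-inverse and a left adjoint of [H], with homogeneous natural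
   isomorphisms as counit and unit. *)
Definition homog_adjoint_equivalence B A (H : kFunctor B A) (I : kFunctor A B)
    (eps : natTrans (kcomp I H) (kid B)) (eta : natTrans (kid A) (kcomp H I)) :
    Prop :=
  [/\ is_adjunction eta eps, natIso eps, natIso eta,
      homogeneousT (B := B) eps & homogeneousT (B := A) eta].

(* The degree adjuster [s] makes [I] into a quasi-inverse [(I, s)] of [H] in
   G-GrCat, with [eps] as counit and [eta] as unit. *)
Definition makes_quasi_inverse B A (H : grFunctor B A) (I : kFunctor A B)
    (eps : natTrans (kcomp I H) (kid B)) (eta : natTrans (kid A) (kcomp H I))
    (s : ob A -> G) : Prop :=
  exists Is_deg : degree_preserving I s,
  let Is := GrFunctor Is_deg in
  exists (eps_deg : degreeT (H := grcomp Is H) (I := grid B) eps)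
         (eta_deg : degreeT (H := grid A) (I := grcomp H Is) eta),
  quasi_inverse (GrTrans eps_deg) (GrTrans eta_deg).

End Graded.

Arguments in_deg {G k B x y} a f : rename.
Arguments adjuster {G k B A} H x : rename.

(* Main.v *)
From Stdlib Require Import IndefiniteDescription.
From HB Require Import structures.
From mathcomp Require Import all_boot all_algebra.
Require Import Defs.

(** A degree preserving, fully faithful [H] reflects degrees: if [H f] is
    homogeneous, the images of the components of [f] lie in pairwise different
    degrees, so all but one of them vanish.  For the same reason the inverse of
    a homogeneous isomorphism is homogeneous.  Now choose homogeneous
    isomorphisms [eta x : x -> H (I x)]; the adjoint quasi-inverse transported
    along them satisfies [H (I f) = eta y ∘ f ∘ (eta x)^-1] and
    [H (eps y) = (eta (H y))^-1], so its degrees, and those of [eps], can be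
    read off after applying [H]. *)

Set Implicit Arguments.
Unset Strict Implicit.
Unset Printing Implicit Defensive.

Import GRing.Theory.
Local Open Scope ring_scope.
Local Open Scope cat_scope.

(** * Cancellation of isomorphisms *)

Section Isomorphisms.
Variables (k : comPzRingType) (C : kCat k).

(** Named so that precomposition can be bundled as a linear map; this is what allows homogeneous
    components to be lifted along it. *)
Definition precomp (x y z : ob C) (f : hom C x y) (g : hom C y z) : hom C x z :=
  g ∘ f.

HB.instance Definition _ x y z f :=
  GRing.isLinear.Build k _ _ _ (@precomp x y z f) (@comp_linearl k C x y z f).

Lemma iso_cancelr (x y z : ob C) (f : hom C x y) (g h : hom C y z) :
  is_iso f -> g ∘ f = h ∘ f -> g = h.
Proof.
by move=> [f' [_ ff']] e; rewrite -[g]compm1 -[h]compm1 -ff' !compA e.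
Qed.

Lemma iso_cancell (x y z : ob C) (f : hom C y z) (g h : hom C x y) :
  is_iso f -> f ∘ g = f ∘ h -> g = h.
Proof.
by move=> [f' [f'f _]] e; rewrite -[g]comp1m -[h]comp1m -f'f -!compA e.
Qed.

End Isomorphisms.

(** * Ordinary equivalences of categories *)

Section Equivalences.
Variable k : comPzRingType.

Lemma natIso_inverse (C D : kCat k) (F F' : kFunctor C D) (t : natTrans F F') :
  natIso t -> exists u : natTrans F' F,
    forall x, u x ∘ t x = idm (F x) /\ t x ∘ u x = idm (F' x).
Proof.
move=> it; pose u0 x := constructive_indefinite_description _ (it x).
have ut x : sval (u0 x) ∘ t x = idm (F x) := (svalP (u0 x)).1.
have tu x : t x ∘ sval (u0 x) = idm (F' x) := (svalP (u0 x)).2.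
have nat_u x y (f : hom C x y) :
    fmap F x y f ∘ sval (u0 x) = sval (u0 y) ∘ fmap F' x y f.
  apply: (iso_cancelr (it x)); apply: (iso_cancell (it y)).
  by rewrite -!compA ut compm1 ntc_nat !compA tu comp1m.
by exists (@NatTrans k C D F' F (fun x => sval (u0 x)) nat_u).
Qed.

(** Naturality reads [h ∘ t x = t y ∘ F' (F h)], so [F h] determines [h ∘ t x], and [t x]
    cancels. *)
Lemma retract_faithful (C D : kCat k) (F : kFunctor C D) (F' : kFunctor D C)
    (t : natTrans (kcomp F' F) (kid C)) :
  natIso t -> forall x y, injective (fmap F x y).
Proof.
move=> it x y f g e; apply: (iso_cancelr (it x)).
have nt h : h ∘ t x = t y ∘ fmap F' _ _ (fmap F x y h) := ntc_nat t h.
by rewrite !nt e.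
Qed.

(** For fullness, [g] is lifted to [f = eps y ∘ F' g ∘ eps' x] with [eps'] inverse to [eps].
    Naturality of [eps] gives [F' (F f) = F' g], and [F'] is faithful because [eta] is
    invertible. *)
Lemma equivalence_fully_faithful (C D : kCat k) (F : kFunctor C D)
    (F' : kFunctor D C) (eps : natTrans (kcomp F' F) (kid C))
    (eta : natTrans (kid D) (kcomp F F')) :
  natIso eps -> natIso eta -> fully_faithful F.
Proof.
move=> ieps ieta x y; split; first exact: retract_faithful ieps x y.
move=> g; have [eps' epsK] := natIso_inverse ieps.
have [eta' etaK] := natIso_inverse ieta.
exists (eps y ∘ fmap F' _ _ g ∘ eps' x).
have ieta' : natIso eta' by move=> z; exists (eta z); have [] := etaK z.
apply: (retract_faithful ieta'); apply: (iso_cancell (ieps y)).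
set f := _ ∘ eps' x.
have <- : f ∘ eps x = eps y ∘ fmap F' _ _ (fmap F x y f) := ntc_nat eps f.
by rewrite -compA (epsK x).1 compm1.
Qed.

Lemma ff_section (C D : kCat k) (F : kFunctor C D) :
  fully_faithful F ->
  exists Finv : forall x y, hom D (F x) (F y) -> hom C x y,
    forall x y g, fmap F x y (Finv x y g) = g.
Proof.
move=> ffF.
pose Fi x y g := constructive_indefinite_description _ ((ffF x y).2 g).
by exists (fun x y g => sval (Fi x y g)) => x y g; exact: svalP (Fi x y g).
Qed.

End Equivalences.

(** * The quasi-inverse transported along chosen isomorphisms *)

Section TransportedInverse.
Variables (k : comPzRingType) (C D : kCat k) (F : kFunctor C D).
Variable Finv : forall x y, hom D (F x) (F y) -> hom C x y.
Hypothesis FK : forall x y (g : hom D (F x) (F y)), fmap F x y (Finv g) = g.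
Hypothesis F_inj : forall x y, injective (fmap F x y).
Variables (L : ob D -> ob C) (e : forall x, hom D x (F (L x))).
Variable e' : forall x, hom D (F (L x)) x.
Hypothesis e'e : forall x, e' x ∘ e x = idm x.
Hypothesis ee' : forall x, e x ∘ e' x = idm (F (L x)).

(** Conjugation by [e], pulled back along [F]: the only choice that makes [e] natural. *)
Definition linv_map x y (f : hom D x y) : hom C (L x) (L y) :=
  Finv (e y ∘ f ∘ e' x).

Fact linv_map_linear x y : linear (@linv_map x y).
Proof.
move=> a f g; apply: F_inj.
by rewrite linearP !FK comp_linearr comp_linearl.
Qed.

HB.instance Definition _ x y :=
  GRing.isLinear.Build k _ _ _ (@linv_map x y) (@linv_map_linear x y).

Fact linv_id x : linv_map (idm x) = idm (L x).
Proof. by apply: F_inj; rewrite FK fmap_id compm1 ee'. Qed.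

Fact linv_comp x y z (g : hom D y z) (f : hom D x y) :
  linv_map (g ∘ f) = linv_map g ∘ linv_map f.
Proof.
apply: F_inj; rewrite fmap_comp !FK !compA; congr (_ ∘ _ ∘ _).
by rewrite -(compA _ (e' y)) e'e compm1.
Qed.

Definition linv : kFunctor D C :=
  @KFunctor k D C L (fun x y => @linv_map x y) linv_id linv_comp.

Fact linv_unit_nat x y (f : hom D x y) :
  fmap (kcomp F linv) x y f ∘ e x = e y ∘ fmap (kid D) x y f.
Proof. by rewrite /= FK -compA e'e compm1. Qed.

Definition linv_unit : natTrans (kid D) (kcomp F linv) :=
  @NatTrans k D D (kid D) (kcomp F linv) e linv_unit_nat.

Fact linv_counit_nat x y (f : hom C x y) :
  fmap (kid C) x y f ∘ Finv (e' (F x)) =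
  Finv (e' (F y)) ∘ fmap (kcomp linv F) x y f.
Proof. by apply: F_inj; rewrite /= !fmap_comp !FK !compA e'e comp1m. Qed.

(** The second triangle identity forces [F] of the counit at [y] to be the inverse [e' (F y)] of the
    unit. *)
Definition linv_counit : natTrans (kcomp linv F) (kid C) :=
  @NatTrans k C C (kcomp linv F) (kid C) (fun y => Finv (e' (F y))) linv_counit_nat.

(** The second identity is built into the counit. Under [F] the first becomes [e' ∘ e ∘ e x ∘ e' x],
    where the left pair, taken at [F (L x)], cancels. *)
Lemma linv_adjunction : is_adjunction linv_unit linv_counit.
Proof.
split=> [x|y] /=; last by rewrite FK e'e.
apply: F_inj; rewrite fmap_comp fmap_id !FK !compA e'e comp1m.
exact: ee'.
Qed.

Lemma linv_unit_iso : natIso linv_unit.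
Proof. by move=> x; exists (e' x); split; [exact: e'e|exact: ee']. Qed.

Lemma linv_counit_iso : natIso linv_counit.
Proof.
move=> y; exists (Finv (e (F y))).
by split; apply: F_inj; rewrite fmap_comp fmap_id !FK ?e'e ?ee'.
Qed.

End TransportedInverse.

(** * Homogeneous components and degrees *)

Section Degrees.
Variables (G : groupType) (k : comPzRingType).

Lemma direct_sumB (V : lmodType k) (W : G -> V -> Prop) a u v :
  direct_sum W -> W a u -> W a v -> W a (u - v).
Proof. by move=> dW Wu Wv; rewrite addrC -scaleN1r; apply: ds_linear. Qed.

Lemma direct_sum_if (V : lmodType k) (W : G -> V -> Prop) a v (b : bool) :
  direct_sum W -> (b -> W a v) -> W a (if b then v else 0).
Proof. by move=> dW; case: b => [|_]; [apply|apply: ds_zero]. Qed.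

Lemma ds_span_at (V : lmodType k) (W : G -> V -> Prop) (a : G) v :
  direct_sum W -> exists (s : seq G) (w : G -> V),
    [/\ uniq s, a \in s, forall b, W b (w b) & v = \sum_(b <- s) w b].
Proof.
move=> dW; have [s [w [us Ww ->]]] := ds_span dW v.
case: (boolP (a \in s)) => [sa|s'a]; first by exists s, w.
(* Outside [s] the values of [w] are arbitrary, so they are reset to 0 before [a] joins the
   support. *)
exists (a :: s), (fun b => if b \in s then w b else 0).
split=> [|||]; rewrite /= ?s'a ?mem_head //.
  by move=> b; apply: direct_sum_if.
rewrite big_cons (negPf s'a) add0r !big_seq.
by apply: eq_bigr => b ->.
Qed.

(* The witness is the component of [v] of degree [a]. *)
Lemma lift_homogeneous (V V' : lmodType k) (W : G -> V -> Prop)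
    (W' : G -> V' -> Prop) (phi : {linear V -> V'}) (sigma tau : G -> G) a v :
  direct_sum W -> direct_sum W' -> cancel sigma tau -> cancel tau sigma ->
  (forall b u, W b u -> W' (sigma b) (phi u)) ->
  W' (sigma a) (phi v) -> exists2 u, W a u & phi u = phi v.
Proof.
move=> dW dW' sK tK phiW Wv.
have [s [w [us sa Ww ev]]] := ds_span_at a v dW.
exists (w a) => //; apply/subr0_eq.
(* Over [map sigma s] this family sums to [phi v - phi v = 0], so independence kills each term, in
   particular the one at [sigma a]. *)
pose w' c := phi (w (tau c)) - (if c == sigma a then phi v else 0).
have ->: phi (w a) - phi v = w' (sigma a) by rewrite /w' sK eqxx.
apply: (ds_indep dW' (s := map sigma s)); last exact: map_f.
- by rewrite map_inj_uniq //; apply: can_inj sK.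
- move=> c; apply: direct_sumB => //; first by rewrite -{1}[c]tK; apply: phiW.
  by apply: direct_sum_if => // /eqP->.
rewrite big_map sumrB; under eq_bigr do rewrite sK.
rewrite -linear_sum -ev (bigD1_seq a) //= eqxx big1 ?addr0 ?subrr // => b ba.
by rewrite (inj_eq (can_inj sK)) (negPf ba).
Qed.

Lemma direct_sum_deg_uniq (V : lmodType k) (W : G -> V -> Prop) a b v :
  direct_sum W -> W a v -> W b v -> v <> 0 -> a = b.
Proof.
move=> dW Wa Wb v0; apply/eqP/negPn/negP => ab; apply: v0.
(* The values [v] in degree [a] and [- v] in degree [b] sum to 0, so independence would force
   [v = 0]. *)
pose w c := if c == a then v else if c == b then - v else 0.
rewrite -[v](_ : w a = v); last by rewrite /w eqxx.
apply: (ds_indep dW (s := [:: a; b])); rewrite ?mem_head //=.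
- by rewrite inE ab.
- move=> c; rewrite /w; case: eqP => [->//|_].
  case: eqP => [->|_]; last exact: ds_zero.
  by rewrite -[- v]add0r; apply: direct_sumB => //; apply: ds_zero.
- by rewrite big_cons big_seq1 /w eqxx eq_sym (negPf ab) eqxx subrr.
Qed.

(** Precomposition with [f] shifts degrees by [a] and sends [g] to the identity, of degree 1. Hence
    some [u] of degree [a^-1] has [u ∘ f = g ∘ f], and [f] cancels. *)
Lemma in_deg_inv (B : grCat G k) (x y : ob B) a (f : hom B x y) g :
  in_deg a f -> g ∘ f = idm x -> f ∘ g = idm y -> in_deg a^-1%g g.
Proof.
move=> fa gf fg.
have [||b u ub||u ua uf] := @lift_homogeneous _ _ _ _ (@precomp k B x y x f)
  (fun b => b * a)%g (fun c => c * a^-1)%g a^-1%g g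
  (in_deg_direct y x) (in_deg_direct x x).
- exact: mulgK.
- exact: mulgVK.
- exact: in_deg_comp.
- by rewrite mulVg /= /precomp gf; apply: in_deg_id.
suff -> : g = u by [].
by apply: (@iso_cancelr _ B _ _ _ f); [exists g|].
Qed.

Lemma homogeneous_inv (B : grCat G k) (x y : ob B) (f : hom B x y) g :
  homogeneous f -> g ∘ f = idm x -> f ∘ g = idm y -> homogeneous g.
Proof. by move=> [a fa] gf fg; exists a^-1%g; apply: in_deg_inv fa gf fg. Qed.

Section Reflection.
Variables (B A : grCat G k) (H : grFunctor B A).
Hypothesis H_inj : forall x y, injective (fmap H x y).

(** The shift of degrees under [H] is a bijection of [G], so [H f] lifts to an arrow of the right
    degree, which injectivity identifies with [f]. *)
Lemma in_deg_reflect x y c (f : hom B x y) :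
  in_deg c (fmap H x y f) ->
  in_deg (adjuster H y * c * (adjuster H x)^-1)%g f.
Proof.
set a := (X in in_deg X f) => fc.
have [||b u||u ua /H_inj <-//] := @lift_homogeneous _ _ _ _ (fmap H x y)
  (fun b => (adjuster H y)^-1 * b * adjuster H x)%g
  (fun c => adjuster H y * c * (adjuster H x)^-1)%g a f
  (in_deg_direct x y) (in_deg_direct _ _).
- by move=> b; rewrite !mulgA mulgV mul1g mulgK.
- by move=> b; rewrite !mulgA mulVg mul1g mulgVK.
- exact: gfun_deg.
- by rewrite /a !mulgA mulVg mul1g mulgVK.
Qed.

Lemma homogeneous_reflect x y (f : hom B x y) :
  homogeneous (fmap H x y f) -> homogeneous f.
Proof. by move=> [c /in_deg_reflect fc]; eexists; exact: fc. Qed.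

End Reflection.

(** The pointwise inverse automatically has the degree of a 2-morphism, by [in_deg_inv]. *)
Lemma grTrans_invertible2 (B A : grCat G k) (H I : grFunctor B A)
    (t : grTrans H I) : natIso t -> invertible2 t.
Proof.
move=> /natIso_inverse[u ut].
have u_deg : degreeT (H := I) (I := H) u.
  move=> x; have [utx tux] := ut x.
  by have := in_deg_inv (gtrans_deg t x) utx tux; rewrite invgM invgK.
by exists (GrTrans u_deg); split=> x; have [] := ut x.
Qed.

Lemma invertible2_natIso (B A : grCat G k) (H I : grFunctor B A)
    (t : grTrans H I) : invertible2 t -> natIso t.
Proof. by move=> [u [ut tu]] x; exists (u x); split; [apply: ut|apply: tu]. Qed.

End Degrees.

(** * Equivalences of graded categories *)

Section Characterization.
Variables (G : groupType) (k : comPzRingType) (B A : grCat G k).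
Variable H : grFunctor B A.

Lemma gr_equivalence_ff_dense :
  gr_equivalence H -> fully_faithful H /\ homog_dense H.
Proof.
move=> [I [eps [eta [/invertible2_natIso ieps /invertible2_natIso ieta]]]].
split; first exact: equivalence_fully_faithful ieps ieta.
move=> x; exists (H (I x)); split; first by exists (I x).
by exists (eta x); split; [eexists; exact: (gtrans_deg eta x)|exact: ieta].
Qed.

Lemma homog_dense_choice :
  homog_dense H ->
  exists (I : ob A -> ob B) (e : forall x, hom A x (H (I x)))
    (e' : forall x, hom A (H (I x)) x),
    forall x, [/\ homogeneous (e x), e' x ∘ e x = idm x
                & e x ∘ e' x = idm (H (I x))].
Proof.
move=> dH.
(* Object, isomorphism and inverse share one sigma type, so that a single choice yields compatible
   data. *)
have ex x : exists p : {y : ob B & hom A x (H y) * hom A (H y) x}%type,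
    [/\ homogeneous (tagged p).1, (tagged p).2 ∘ (tagged p).1 = idm x
      & (tagged p).1 ∘ (tagged p).2 = idm (H (tag p))].
  have [_ [[y ->] [f [hf [g [gf fg]]]]]] := dH x.
  by exists (existT _ y (f, g)).
pose p x := constructive_indefinite_description _ (ex x).
exists (fun x => tag (sval (p x))), (fun x => (tagged (sval (p x))).1).
by exists (fun x => (tagged (sval (p x))).2) => x; exact: svalP (p x).
Qed.

Lemma ff_dense_adjoint :
  fully_faithful H -> homog_dense H ->
  exists (I : kFunctor A B) (eps : natTrans (kcomp I H) (kid B))
    (eta : natTrans (kid A) (kcomp H I)), homog_adjoint_equivalence eps eta.
Proof.
move=> ffH dH; have H_inj x y := (ffH x y).1.
have [Hinv HK] := ff_section ffH.
have [I [e [e' eP]]] := homog_dense_choice dH.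
have e'e x : e' x ∘ e x = idm x by have [] := eP x.
have ee' x : e x ∘ e' x = idm (H (I x)) by have [] := eP x.
exists (linv HK H_inj e'e ee'), (linv_counit HK H_inj e'e ee').
exists (linv_unit HK H_inj e'e ee').
split; [exact: linv_adjunction|exact: linv_counit_iso|exact: linv_unit_iso| |].
  (* [H] sends the counit at [y] to [e' (H y)], the inverse of a homogeneous isomorphism. *)
  move=> y; apply: (homogeneous_reflect H_inj); rewrite HK.
  by have [he eF Fe] := eP (H y); apply: homogeneous_inv he eF Fe.
by move=> x; have [] := eP x.
Qed.

(** * The degree adjuster of an adjoint quasi-inverse *)

Section Adjuster.
Variables (I : kFunctor A B) (eps : natTrans (kcomp I H) (kid B)).
Variable eta : natTrans (kid A) (kcomp H I).
Hypothesis adj : homog_adjoint_equivalence eps eta.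

Let ieps : natIso eps. Proof. by case: adj. Qed.
Let ieta : natIso eta. Proof. by case: adj. Qed.
Let H_inj x y : injective (fmap H x y).
Proof. exact: retract_faithful ieps x y. Qed.

Lemma adjuster_makes_quasi_inverse (s : ob A -> G) :
  (forall x, exists a,
    in_deg a (eta x) /\ s x = (a^-1 * (adjuster H (I x))^-1)%g) ->
  makes_quasi_inverse eps eta s.
Proof.
move=> sP; have [eta' etaK] := natIso_inverse ieta.
(* The formula for [s x], solved for the degree of [eta x]; this is exactly the 2-morphism condition
   on [eta]. *)
have eta_s x : in_deg (s x * adjuster H (I x))^-1%g (eta x).
  by have [a [etaa ->]] := sP x; rewrite mulgVK invgK.
have eta'_s x : in_deg (s x * adjuster H (I x))%g (eta' x).
  by have [e'e ee'] := etaK x; have := in_deg_inv (eta_s x) e'e ee'; rewrite invgK.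
have I_deg : degree_preserving I s.
  move=> x y a f fa.
  have HIf : fmap H _ _ (fmap I x y f) = eta y ∘ (f ∘ eta' x).
    have nat_f : fmap H _ _ (fmap I x y f) ∘ eta x = eta y ∘ f := ntc_nat eta f.
    by rewrite compA -nat_f -compA (etaK x).2 compm1.
  have := in_deg_comp (eta_s y) (in_deg_comp fa (eta'_s x)).
  rewrite -HIf => /(in_deg_reflect H_inj).
  by rewrite invgM !mulgA mulgV mul1g mulgK.
have eps_deg : degreeT (H := grcomp (GrFunctor I_deg) H) (I := grid B) eps.
  move=> y /=.
  (* The triangle identity at [H y] makes [H (eps y)] a left inverse of [eta (H y)]. *)
  have Heps : fmap H _ _ (eps y) = eta' (H y).
    case: adj => -[_ tri] _ _ _ _; apply: (iso_cancelr (ieta (H y))).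
    by rewrite tri (etaK _).1.
  have := eta'_s (H y); rewrite -Heps => /(in_deg_reflect H_inj).
  by rewrite invg1 mul1g mulgA mulgK.
have eta_deg : degreeT (H := grid A) (I := grcomp H (GrFunctor I_deg)) eta.
  by move=> x /=; rewrite mulg1; exact: eta_s.
exists I_deg, eps_deg, eta_deg.
by split; apply: grTrans_invertible2.
Qed.

Lemma makes_quasi_inverse_adjuster (s : ob A -> G) :
  makes_quasi_inverse eps eta s ->
  forall x, exists a,
    in_deg a (eta x) /\ s x = (a^-1 * (adjuster H (I x))^-1)%g.
Proof.
(* The witness is the degree that the 2-morphism condition assigns to [eta x]. *)
move=> [I_deg [_ [eta_deg _]]] x; exists (s x * adjuster H (I x))^-1%g.
by split; [have := eta_deg x; rewrite /= mulg1|rewrite invgK mulgK].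
Qed.

Lemma makes_quasi_inverse_exists : exists s, makes_quasi_inverse eps eta s.
Proof.
have heta : forall x, homogeneous (B := A) (eta x) by case: adj.
pose a x := constructive_indefinite_description _ (heta x).
exists (fun x => (sval (a x))^-1 * (adjuster H (I x))^-1)%g.
apply: adjuster_makes_quasi_inverse => x; exists (sval (a x)).
by split=> //; exact: svalP (a x).
Qed.

Lemma makes_quasi_inverse_uniq s s' :
  makes_quasi_inverse eps eta s -> makes_quasi_inverse eps eta s' ->
  forall x, eta x <> 0 -> s x = s' x.
Proof.
move=> /makes_quasi_inverse_adjuster sP /makes_quasi_inverse_adjuster s'P x nz.
have [[a [etaa ->]] [b [etab ->]]] := (sP x, s'P x).
by rewrite (direct_sum_deg_uniq (in_deg_direct _ _) etaa etab nz).
Qed.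

Lemma adjoint_gr_equivalence : gr_equivalence H.
Proof.
have [s [I_deg [eps_deg [eta_deg qi]]]] := makes_quasi_inverse_exists.
by exists (GrFunctor I_deg), (GrTrans eps_deg), (GrTrans eta_deg).
Qed.

End Adjuster.

End Characterization.

Theorem theorem9p5 (G : groupType) (k : comPzRingType) (B A : grCat G k)
    (H : grFunctor B A) :
  (gr_equivalence H <->
     exists (I : kFunctor A B) (eps : natTrans (kcomp I H) (kid B))
       (eta : natTrans (kid A) (kcomp H I)),
       homog_adjoint_equivalence eps eta) /\
  (gr_equivalence H <-> fully_faithful H /\ homog_dense H) /\
  (forall (I : kFunctor A B) (eps : natTrans (kcomp I H) (kid B))
      (eta : natTrans (kid A) (kcomp H I)),
     homog_adjoint_equivalence eps eta ->
     [/\ (exists s : ob A -> G, makes_quasi_inverse eps eta s),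
         (* s x = (deg (eta x))^-1 * (r (I x))^-1; when eta x = 0, any choice
            of deg (eta x) is allowed *)
         (forall s : ob A -> G,
            makes_quasi_inverse eps eta s <->
            forall x : ob A, exists a : G,
              in_deg a (eta x) /\ s x = (a^-1 * (adjuster H (I x))^-1)%g)
       & (* s is unique wherever the degree of eta x is determined *)
         (forall s s' : ob A -> G,
            makes_quasi_inverse eps eta s -> makes_quasi_inverse eps eta s' ->
            forall x : ob A, eta x <> 0%R -> s x = s' x)]).
Proof.
(* The equivalences close up as a cycle: graded equivalence, then fully faithful and dense, then
   homogeneous adjoint, then graded equivalence again. *)
have adj_eq : (exists (I : kFunctor A B) (eps : natTrans (kcomp I H) (kid B))
    (eta : natTrans (kid A) (kcomp H I)), homog_adjoint_equivalence eps eta) ->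
    gr_equivalence H.
  by move=> [I [eps [eta adj]]]; apply: adjoint_gr_equivalence adj.
split; [|split].
- split=> // /gr_equivalence_ff_dense[ffH dH]; exact: ff_dense_adjoint.
- split; first exact: gr_equivalence_ff_dense.
  by move=> [ffH dH]; apply/adj_eq/ff_dense_adjoint.
move=> I eps eta adj; split; first exact: makes_quasi_inverse_exists.
  by move=> s; split; [apply: makes_quasi_inverse_adjuster
                      |apply: adjuster_makes_quasi_inverse].
exact: makes_quasi_inverse_uniq.
Qed.
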